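(* Let $\widehat{\mathbb R}$ be a field satisfying Axioms 1--5 (listed in the context), let $\widehat{\mathbb C}=\widehat{\mathbb R}(i)$, and let $s$ be a fixed infinitesimal scale of $\widehat{\mathbb R}$, with associated valuation $v_s$ and metric $d_s$. Then: (i) $\widehat{\mathbb C}$ is an algebraically closed field. ($\widehat{\mathbb C}$ is endowed with the product topology inherited from the order topology on $\widehat{\mathbb R}$.) (ii) Both $(\widehat{\mathbb R},d_s)$ and $(\widehat{\mathbb C},d_s)$ are spherically complete ultra-metric spaces, in the sense that every nested sequence of closed balls in $\widehat{\mathbb R}$ (respectively in $\widehat{\mathbb C}$) has non-empty intersection. Consequently, both $\widehat{\mathbb R}$ and $\widehat{\mathbb C}$ are also sequentially complete. (iii) The order topology (on $\widehat{\mathbb R}$), respectively the product-order topology (on $\widehat{\mathbb C}$), coincides with the topology of the metric $d_s$. (iv) Let $(a_n)$ be a sequence in $\widehat{\mathbb C}$. Then the following are equivalent: $\lim_{n\to\infty}a_n=0$; $\lim_{n\to\infty}v_s(a_n)=\infty$; the series $\sum_{n=0}^\infty a_n$ is convergent in $\widehat{\mathbb C}$.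
   Context: The set-theoretic framework is ZFC together with $2^{\mathfrak c}=\mathfrak c^+$, where $\mathfrak c=\operatorname{card}(\mathbb R)$. For a cardinal $\kappa$, $\kappa^+$ denotes its successor. For a totally ordered field $\mathbb K$, $\mathbb K_+$ is the set of its positive elements, $x\in\mathbb K$ is infinitesimal (written $x\approx 0$) if $|x|<1/n$ for all $n\in\mathbb N=\{1,2,\dots\}$, finite if $|x|\le n$ for some $n\in\mathbb N$, and $\mathcal F(\mathbb K)$ is the set of finite elements. Real closed fields are given their unique field order. A totally ordered field $\mathbb K$ with $\operatorname{card}(\mathbb K)=\kappa^+$, $\kappa$ an infinite cardinal, is Cantor complete if every family $\{[a_\gamma,b_\gamma]\}_{\gamma\in\Gamma}$ of bounded closed intervals in $\mathbb K$ with the finite intersection property and $\operatorname{card}(\Gamma)\le\kappa$ has non-empty intersection. An infinitesimal scale of $\mathbb K$ is a positive infinitesimal $s\in\mathbb K$ such that the sequence $(s^{-n})_{n\in\mathbb N}$ is unbounded from above in $\mathbb K$. Axioms for $\widehat{\mathbb R}$: Axiom 1: $\operatorname{card}(\widehat{\mathbb R})=\mathfrak c^+$. Axiom 2: $\widehat{\mathbb R}$ is a real closed Cantor complete field. Axiom 3: $\widehat{\mathbb R}$ contains $\mathbb R$ as a subfield. Axiom 4: $\widehat{\mathbb R}$ admits an infinitesimal scale. Axiom 5: for every infinitesimal scale $s\in\widehat{\mathbb R}$ there is a strictly decreasing function $\exp_s:\mathcal F(\widehat{\mathbb R})\to\widehat{\mathbb R}_+$ which is a group isomorphism from $(\mathcal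 F(\widehat{\mathbb R}),+)$ onto $(\widehat{\mathbb R}_+,\cdot)$ such that $\exp_s(q)=s^q$ for all $q\in\mathbb Q$. For $z=x+iy\in\widehat{\mathbb C}$ with $x,y\in\widehat{\mathbb R}$, $|z|=\sqrt{x^2+y^2}\in\widehat{\mathbb R}$. The valuation $v_s:\widehat{\mathbb C}\to\mathbb R\cup\{\infty\}$ is $v_s(0)=\infty$ and $v_s(x)=\sup\{q\in\mathbb Q: |x|/s^q\approx 0\}$ for $x\ne0$; the metric is $d_s(x,y)=e^{-v_s(x-y)}$ (with $e^{-\infty}=0$), restricted to $\widehat{\mathbb R}$ when speaking of $(\widehat{\mathbb R},d_s)$. A closed ball is a set $\{y: d_s(x,y)\le r\}$ with $r>0$ real. *)

(* Defs.v *)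
From HB Require Import structures.
From mathcomp Require Import all_boot all_order all_algebra.
From mathcomp Require Import complex.
From mathcomp Require Import all_classical all_reals all_analysis.
Set Implicit Arguments.
Unset Strict Implicit.
Unset Printing Implicit Defensive.
Import Order.TTheory GRing.Theory Num.Theory.
Import numFieldNormedType.Exports.
Local Open Scope classical_set_scope.
Local Open Scope ring_scope.

Definition card_lt (T U : Type) : Prop :=
  ([set: T] #<= [set: U])%card /\ ~ ([set: U] #<= [set: T])%card.

(* card U = (card T)^+ *)
Definition is_succ_card (T U : Type) : Prop :=
  card_lt T U /\
  forall V : Type, card_lt T V -> ([set: U] #<= [set: V])%card.

Section OrderedFields.
Variable K : rcfType.
Implicit Types x s : K.

Definition infinitesimal x : Prop :=
  forall n : nat, (0 < n)%N -> `|x| < n%:R^-1.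

Definition finite_elt x : Prop :=
  exists2 n : nat, (0 < n)%N & `|x| <= n%:R.

(* The type T plays the role of kappa: it is determined up to bijection by
   card K = kappa^+. *)
Definition cantor_complete : Prop :=
  exists T : Type,
    [/\ infinite_set [set: T],
        is_succ_card T K &
        forall (I : choiceType) (a b : I -> K),
          ([set: I] #<= [set: T])%card ->
          finI [set: I] (fun i => [set` `[a i, b i]]) ->
          \bigcap_(i in [set: I]) [set` `[a i, b i]] !=set0].

Definition infinitesimal_scale s : Prop :=
  [/\ 0 < s, infinitesimal s &
      ~ has_ubound [set s ^- n | n in [set n : nat | (0 < n)%N]]].

(* s ^ (m / n) is the positive n-th root of s ^ m *)
Definition ratpow s (q : rat) : K :=
  xget 0 [set y : K | 0 < y /\ y ^+ `|denq q|%N = s ^ numq q].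

Lemma ratpowP s (q : rat) : 0 < s ->
  0 < ratpow s q /\ ratpow s q ^+ `|denq q|%N = s ^ numq q.
Proof.
move=> s0; rewrite /ratpow; case: xgetP => [y _ //|h]; exfalso.
have n0 : (0 < `|denq q|)%N by rewrite absz_gt0 denq_neq0.
set n := `|denq q|%N in n0 h *; set c := s ^ numq q in h *.
have c0 : 0 < c by apply: exprz_gt0.
have c1 : 0 <= 1 + c by rewrite addr_ge0 // ltW.
have p0 : ('X^n - c%:P).[0] <= 0 <= ('X^n - c%:P).[1 + c].
  rewrite !hornerE expr0n eqn0Ngt n0 /= sub0r oppr_le0 ltW //=.
  rewrite subr_ge0 (@le_trans _ _ (1 + c)) ?lerDr //.
  by apply: ler_eXnr; rewrite // lerDl ltW.
have [y /andP[y0 _]] := poly_ivt c1 p0.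
rewrite /root !hornerE subr_eq0 => /eqP yc; apply: (h y); split => //.
rewrite lt_def y0 andbT; apply: contraTneq c0 => y00.
by rewrite -yc y00 expr0n eqn0Ngt n0 ltxx.
Qed.

Lemma ratpow_uniq s (q : rat) (y : K) : 0 < s ->
  0 < y -> y ^+ `|denq q|%N = s ^ numq q -> y = ratpow s q.
Proof.
move=> s0 y0 yE; have [r0 rE] := ratpowP q s0.
apply/eqP; rewrite -(@eqrXn2 _ `|denq q|%N) ?ltW ?yE ?rE //.
by rewrite absz_gt0 denq_neq0.
Qed.

(* Only the restriction of exps to the finite elements is constrained. *)
Definition has_exponentials : Prop :=
  forall s, infinitesimal_scale s ->
  exists exps : K -> K,
    [/\ set_bij [set x | finite_elt x] [set y | 0 < y] exps,
        forall x y, finite_elt x -> finite_elt y ->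
          exps (x + y) = exps x * exps y,
        forall x y, finite_elt x -> finite_elt y ->
          x < y -> exps y < exps x &
        forall q : rat, exps (ratr q) = ratpow s q].

End OrderedFields.

Record Rhat_axioms (R : realType) (K : rcfType) : Prop := {
  Rhat_card : is_succ_card R K;
  Rhat_cantor : cantor_complete K;
  Rhat_subfield : inhabited {rmorphism R -> K};
  Rhat_scale : exists s : K, infinitesimal_scale s;
  Rhat_exp : has_exponentials K
}.

Section Valuation.
Variables (R : realType) (K : rcfType).
Implicit Types s : K.

Definition vs s (x : K[i]) : \bar R :=
  if x == 0 then +oo%E
  else (sup [set ratr q | q in
          [set q : rat | infinitesimal (Normc.normc x / ratpow s q)]])%:E.

Definition dsC s (x y : K[i]) : R := fine (expeR (- vs s (x - y)%R)).

Definition dsR s (x y : K) : R := dsC s (x%:C)%C (y%:C)%C.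

End Valuation.

Section Metric.
Variables (R : realType) (T : Type) (d : T -> T -> R).

Definition is_ultrametric : Prop :=
  [/\ forall x y, 0 <= d x y,
      forall x y, d x y = 0 <-> x = y,
      forall x y, d x y = d y x &
      forall x y z, d x z <= Num.max (d x y) (d y z)].

Definition dball_closed (x : T) (r : R) : set T := [set y | d x y <= r].

Definition spherically_complete : Prop :=
  forall (c : nat -> T) (r : nat -> R),
    (forall n, 0 < r n) ->
    (forall n, dball_closed (c n.+1) (r n.+1) `<=` dball_closed (c n) (r n)) ->
    \bigcap_n dball_closed (c n) (r n) !=set0.

Definition sequentially_complete : Prop :=
  forall a : nat -> T,
    (forall e : R, 0 < e -> exists N : nat,
       forall m n, (N <= m)%N -> (N <= n)%N -> d (a m) (a n) < e) ->
    exists l : T, d (a n) l @[n --> \oo] --> (0 : R).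

Definition metric_open (U : set T) : Prop :=
  forall x, U x -> exists2 r : R, 0 < r & [set y | d x y < r] `<=` U.

End Metric.

(* K[i] also has a library topology coming from its K[i]-valued norm; we use
   instead the product of the order topologies, carried over from K * K by
   the bijection z |-> (Re z, Im z). *)
Definition prod_order_topology (K : rcfType) : topologicalType :=
  initial_topology (fun z : K[i] =>
    (complex.Re z, complex.Im z) : order_topology K * order_topology K).

Definition converges (T : topologicalType) (a : nat -> T) (l : T) : Prop :=
  a @ \oo --> l.

(* Main.v *)
(* Everything rests on two estimates comparing the valuation with rational
   powers of the scale: [|z| <= s ^ q] implies [q <= v_s z], and [q < v_s z]
   implies [|z| < s ^ q].  They make a closed ball for [d_s] in [K] the
   intersection of the countably many intervals of radius [s ^ q] with [q]
   rational below the level of the ball, so a nested sequence of balls is a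
   countable family of intervals with the finite intersection property, to
   which Cantor completeness applies.  Balls in [K[i]] are products of balls
   of [K].  Since the powers [s ^ n] are coinitial among the positive
   elements, balls and intervals define the same neighbourhoods; convergence
   of series is then the usual non-archimedean Cauchy criterion. *)
Require Import Defs.
From mathcomp Require Import all_boot all_order all_algebra.
From mathcomp Require Import complex.
From mathcomp Require Import all_classical all_reals all_analysis.
From mathcomp Require Import lra.
Import Order.TTheory GRing.Theory Num.Theory.
Local Open Scope classical_set_scope.
Local Open Scope ring_scope.

Set Implicit Arguments.
Unset Strict Implicit.

Lemma rat_dense {R : realType} (x y : R) :
  x < y -> exists2 q : rat, x < ratr q & ratr q < y.
Proof.
by move=> /rat_in_itvoo[q]; rewrite in_itv /= => /andP[xq qy]; exists q.
Qed.

(** * Rational powers of the scale *)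

Section RationalPowers.
Context {K : rcfType} {s : K} (s0 : 0 < s).

Lemma ratpow_gt0 (q : rat) : 0 < ratpow s q.
Proof. by have [] := ratpowP q s0. Qed.

(** Frees [ratpow] from the reduced fraction of its definition, so that common denominators can be
    used. Both sides have the same power of exponent [b * d], which determines a positive
    element. *)
Lemma ratpow_frac (y : K) (a : int) (b : nat) (q : rat) :
  0 < y -> (0 < b)%N -> y ^+ b = s ^ a -> q * b%:R = a%:~R -> y = ratpow s q.
Proof.
move=> y0 b0 yE qE; have [r0 rE] := ratpowP q s0.
set d := `|denq q|%N in rE *.
have d0 : (0 < d)%N by rewrite absz_gt0 denq_neq0.
have dE : (d : int) = denq q by rewrite /d absz_denq.
apply/eqP; rewrite -(@eqrXn2 _ (b * d)) ?ltW ?muln_gt0 ?b0 //.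
rewrite exprM yE mulnC exprM rE !exprnP !exprz_exp.
suff -> : a * d%:Z = numq q * b%:Z by [].
apply/(@intr_inj rat); rewrite !intrM -qE dE numqE -!pmulrn.
by rewrite mulrAC.
Qed.

Lemma ratpowD (p q : rat) : ratpow s (p + q) = ratpow s p * ratpow s q.
Proof.
have [p0 pE] := ratpowP p s0; have [q0 qE] := ratpowP q s0.
set c := `|denq p|%N in pE; set d := `|denq q|%N in qE.
have d0 : (0 < d)%N by rewrite absz_gt0 denq_neq0.
have c0 : (0 < c)%N by rewrite absz_gt0 denq_neq0.
apply/esym/(@ratpow_frac _ (numq p * d%:Z + numq q * c%:Z) (c * d)).
- exact: mulr_gt0.
- by rewrite muln_gt0 c0.
- rewrite exprMn exprM pE mulnC exprM qE expfzDr ?gt_eqF//.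
  by rewrite -!exprz_exp -!exprnP.
- have E (r : rat) : r * `|denq r|%N%:R = (numq r)%:~R.
    by rewrite numqE pmulrn absz_denq.
  rewrite intrD !intrM -!E -!pmulrn natrM -/c -/d.
  by rewrite mulrDl mulrA [c%:R * _]mulrC mulrA.
Qed.

Lemma ratpow_nat (n : nat) : ratpow s n%:R = s ^+ n.
Proof.
apply/esym/(@ratpow_frac _ n 1) => //; first exact: exprn_gt0.
by rewrite mulr1.
Qed.

(** If [1 / n <= s ^ q], raising to the denominator [d] of [q] gives [1 / n ^ d <= s ^ numq q <= s],
    against [s] being infinitesimal. *)
Lemma ratpow_infinitesimal (q : rat) :
  infinitesimal s -> 0 < q -> infinitesimal (ratpow s q).
Proof.
move=> si q0 n n0; have [r0 rE] := ratpowP q s0; rewrite gtr0_norm //.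
rewrite ltNge; apply/negP => le_r.
set d := `|denq q|%N in rE *.
have numE : numq q = `|numq q|%N by rewrite gez0_abs // numq_ge0 ltW.
have num0 : (0 < `|numq q|%N)%N by rewrite absz_gt0 numq_eq0 gt_eqF.
have s1 : s <= 1 by move: (si 1%N isT); rewrite invr1 gtr0_norm // => /ltW.
have : s ^ numq q <= s.
  by rewrite numE -exprnP ler_iXnr // ltW.
rewrite -rE; apply/negP; rewrite -ltNge.
have nd0 : (0 < n ^ d)%N by rewrite expn_gt0 n0.
move: (si _ nd0); rewrite gtr0_norm // => /lt_le_trans; apply.
by rewrite natrX -exprVn lerXn2r ?nnegrE ?invr_ge0 ?ler0n ?(ltW r0).
Qed.

(** The quotient [s ^ (q - p)] is infinitesimal, hence below [1 / n]. The case [n = 2] later absorbs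
    the factor two of triangle inequalities. *)
Lemma ratpow_mulrn_le (p q : rat) (n : nat) :
  infinitesimal s -> p < q -> ratpow s q *+ n <= ratpow s p.
Proof.
move=> si pq; case: n => [|n]; first by rewrite mulr0n ltW ?ratpow_gt0.
rewrite -[q](subrK p) ratpowD -mulr_natr mulrAC.
rewrite ler_piMl ?(ltW (ratpow_gt0 _)) //.
rewrite -ler_pdivlMr ?ltr0Sn // mul1r.
have qp : 0 < q - p by rewrite subr_gt0.
by apply/ltW/(le_lt_trans (ler_norm _))/(ratpow_infinitesimal si qp).
Qed.

Lemma ratpow_le (p q : rat) :
  infinitesimal s -> p <= q -> ratpow s q <= ratpow s p.
Proof.
move=> si; rewrite le_eqVlt => /predU1P[-> //|pq].
exact: (ratpow_mulrn_le 1).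
Qed.

End RationalPowers.

(** Otherwise [e^-1] would bound all the powers [s ^- n]. *)
Lemma scale_exp_lt {K : rcfType} {s e : K} :
  infinitesimal_scale s -> 0 < e -> exists n : nat, s ^+ n < e.
Proof.
move=> [s0 _ sU] e0; apply: contrapT => /forallNP h; apply: sU.
exists e^-1 => _ /= [n _ <-]; rewrite lef_pV2 ?posrE ?exprn_gt0 //.
by rewrite leNgt; apply/negP/h.
Qed.

Lemma infinitesimal_le {K : rcfType} {x y : K} :
  infinitesimal y -> `|x| <= `|y| -> infinitesimal x.
Proof. by move=> yi xy n n0; apply: le_lt_trans xy (yi _ n0). Qed.

(** * The modulus on [K[i]] against real and imaginary parts *)

Lemma normc_ge0 {K : rcfType} (z : K[i]) : 0 <= Normc.normc z.
Proof. by case: z => a b /=; rewrite sqrtr_ge0. Qed.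

Lemma normcR {K : rcfType} (x : K) : Normc.normc (x%:C)%C = `|x|.
Proof. by rewrite /= expr0n addr0 sqrtr_sqr. Qed.

Lemma normc_Re_le {K : rcfType} (z : K[i]) :
  `|complex.Re z| <= Normc.normc z.
Proof.
by case: z => a b /=; rewrite -sqrtr_sqr ler_sqrt ?lerDl ?addr_ge0 ?sqr_ge0.
Qed.

Lemma normc_Im_le {K : rcfType} (z : K[i]) :
  `|complex.Im z| <= Normc.normc z.
Proof.
by case: z => a b /=; rewrite -sqrtr_sqr ler_sqrt ?lerDr ?addr_ge0 ?sqr_ge0.
Qed.

Lemma normc_le_ReIm {K : rcfType} (z : K[i]) :
  Normc.normc z <= `|complex.Re z| + `|complex.Im z|.
Proof.
case: z => a b /=; rewrite -ler_sqr ?nnegrE ?sqrtr_ge0 ?addr_ge0 //.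
rewrite sqr_sqrtr ?addr_ge0 ?sqr_ge0 // sqrrD !real_normK ?num_real //.
by rewrite lerD2r lerDl mulrn_wge0 ?mulr_ge0.
Qed.

(** * The valuation and its ultrametric *)

Section Valuation.
Context {R : realType} {K : rcfType} {s : K} (hs : infinitesimal_scale s).

Let s0 : 0 < s. Proof. by case: hs. Qed.
Let si : infinitesimal s. Proof. by case: hs. Qed.

Let expo (z : K[i]) : set R :=
  [set ratr q | q in
    [set q : rat | infinitesimal (Normc.normc z / ratpow s q)]].

Lemma infinitesimal_div_ratpow (x : K) (p q : rat) :
  0 <= x -> x <= ratpow s q -> p < q -> infinitesimal (x / ratpow s p).
Proof.
move=> x0 xq pq; have qp : 0 < q - p by rewrite subr_gt0.
apply: infinitesimal_le (ratpow_infinitesimal s0 si qp) _.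
rewrite !ger0_norm ?divr_ge0 ?(ltW (ratpow_gt0 s0 _)) //.
by rewrite ler_pdivrMr ?ratpow_gt0 // -ratpowD // subrK.
Qed.

Lemma div_ratpow_infinitesimal (x : K) (q : rat) :
  infinitesimal (x / ratpow s q) -> x < ratpow s q.
Proof.
move=> /(_ 1%N isT); rewrite invr1 => /(le_lt_trans (ler_norm _)).
by rewrite ltr_pdivrMr ?ratpow_gt0 // mul1r.
Qed.

(** Ensures that [sup] is a genuine supremum and not its default value. If [s ^ n < 1 / |z|], then
    [- n - 1] is an exponent of [z], the [- 1] making the quotient infinitesimal; if [s ^ n < |z|],
    then [n] is an upper bound. *)
Let expo_has_sup (z : K[i]) : z != 0 -> has_sup (expo z).
Proof.
move=> z0; have nz0 : 0 < Normc.normc z.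
  rewrite lt_def normc_ge0 andbT; apply: contra_neq z0.
  exact: Normc.eq0_normc.
split.
- have [n sn] : exists n, s ^+ n < (Normc.normc z)^-1.
    by apply: scale_exp_lt => //; rewrite invr_gt0.
  exists (ratr (- n%:R - 1)), (- n%:R - 1) => //=.
  apply: (@infinitesimal_div_ratpow _ _ (- n%:R)); first exact: ltW.
    have nE : ratpow s (- n%:R) * s ^+ n = 1.
      by rewrite -ratpow_nat // -ratpowD // addNr (@ratpow_nat _ _ s0 0).
    rewrite -[leRHS](mulfK (lt0r_neq0 (exprn_gt0 n s0))) nE mul1r.
    by rewrite -[leLHS]invrK lef_pV2 ?posrE ?exprn_gt0 ?invr_gt0 ?ltW.
  by rewrite ltrBlDr ltrDl.
- have [n sn] := scale_exp_lt hs nz0.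
  exists n%:R => _ /= [q /div_ratpow_infinitesimal zq <-].
  rewrite -[n%:R](@ratr_nat R) ler_rat leNgt; apply/negP => nq.
  have := lt_trans sn zq; rewrite -ratpow_nat // ltNge.
  by rewrite ratpow_le // ltW.
Qed.

Let vsE (z : K[i]) : z != 0 -> vs R s z = (sup (expo z))%:E.
Proof. by rewrite /vs => /negPf ->. Qed.

Lemma vs_eqy (z : K[i]) : vs R s z = +oo%E <-> z = 0.
Proof. by rewrite /vs; case: eqVneq => // /eqP. Qed.

Lemma vs_gt_ninfty (z : K[i]) : (-oo < vs R s z)%E.
Proof. by rewrite /vs; case: ifP => // _; rewrite ltNyr. Qed.

Lemma vs_ge_rat (z : K[i]) (q : rat) :
  Normc.normc z <= ratpow s q -> ((ratr q)%:E <= vs R s z)%E.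
Proof.
move=> zq; have [->|z0] := eqVneq z 0; first by rewrite /vs eqxx leey.
(* A rational [p] strictly between the supremum and [q] would itself be an exponent of [z]. *)
rewrite vsE // lee_fin leNgt; apply/negP => /rat_dense[p pp].
rewrite ltr_rat => pq.
move: pp; rewrite ltNge => /negP; apply; apply: ub_le_sup.
  exact: (expo_has_sup z0).2.
by exists p => //=; apply: infinitesimal_div_ratpow zq pq; exact: normc_ge0.
Qed.

Lemma vs_gt_rat (z : K[i]) (q : rat) :
  ((ratr q)%:E < vs R s z)%E -> Normc.normc z < ratpow s q.
Proof.
have [-> _|z0] := eqVneq z 0; first by rewrite Normc.normc0 ratpow_gt0.
rewrite vsE // lte_fin => /(sup_gt (expo_has_sup z0).1)[_ [p pz <-]].
rewrite ltr_rat => qp.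
by apply: lt_le_trans (div_ratpow_infinitesimal pz) _; apply/ratpow_le/ltW.
Qed.

(** Turns a real level into inequalities in [K], where only rational powers of [s] are at hand. *)
Lemma vs_geP (z : K[i]) (r : R) : (r%:E <= vs R s z)%E <->
  forall q : rat, ratr q < r -> Normc.normc z <= ratpow s q.
Proof.
split=> [rz q qr|h].
  by apply/ltW/vs_gt_rat; apply: lt_le_trans rz; rewrite lte_fin.
rewrite leNgt; apply/negP; have := vs_gt_ninfty z.
case E : (vs R s z) => [v| |] // _; rewrite lte_fin => /rat_dense[q vq].
move=> /h/vs_ge_rat.
by rewrite E lee_fin leNgt vq.
Qed.

Lemma vs_gtP (z : K[i]) (r : R) : (r%:E < vs R s z)%E <->
  exists2 q : rat, r < ratr q & Normc.normc z <= ratpow s q.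
Proof.
split=> [|[q rq /vs_ge_rat]]; last by apply: lt_le_trans; rewrite lte_fin.
case E : (vs R s z) => [v| |] //.
- rewrite lte_fin => /rat_dense[q rq qv].
  by exists q => //; apply/ltW/vs_gt_rat; rewrite E lte_fin.
- move=> _; have /rat_dense[q rq _] : r < r + 1 by rewrite ltrDl.
  exists q => //; apply/ltW/vs_gt_rat.
  by rewrite E ltry.
Qed.

(** Positivity of [r] makes [expR] invert [ln]. For [x = y] the valuation is [+oo], the distance is
    [0], and both sides hold. *)
Lemma dsC_leP (x y : K[i]) (r : R) : 0 < r ->
  dsC R s x y <= r <-> ((- ln r)%:E <= vs R s (x - y)%R)%E.
Proof.
move=> r0; rewrite /dsC; have := vs_gt_ninfty (x - y).
case: (vs R s (x - y)) => [v| |] //= _; last by rewrite leey ltW.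
by rewrite lee_fin lerNl -[in X in _ <-> X]ler_expR lnK.
Qed.

Lemma dsC_ltP (x y : K[i]) (r : R) : 0 < r ->
  dsC R s x y < r <-> ((- ln r)%:E < vs R s (x - y)%R)%E.
Proof.
move=> r0; rewrite /dsC; have := vs_gt_ninfty (x - y).
case: (vs R s (x - y)) => [v| |] //= _; last by rewrite ltry.
by rewrite lte_fin ltrNl -[in X in _ <-> X]ltr_expR lnK.
Qed.

Lemma dsC_ultrametric : is_ultrametric (@dsC R K s).
Proof.
have d0 x y : 0 <= dsC R s x y by rewrite fine_ge0 ?expeR_ge0.
have d_eq0 x y : dsC R s x y = 0 <-> x = y.
  rewrite /dsC; split => [|->]; last by rewrite subrr /vs eqxx.
  have [//|xy] := eqVneq x y.
  have : vs R s (x - y) <> +oo%E.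
    by move/vs_eqy/eqP; rewrite subr_eq0 (negPf xy).
  have := vs_gt_ninfty (x - y).
  by case: (vs R s (x - y)) => [v| |] //= _ _ /eqP; rewrite expR_eq0.
split=> //.
- by move=> x y; rewrite /dsC /vs -opprB oppr_eq0 normcN.
- move=> x y z; set r := Num.max _ _.
  have rx : dsC R s x y <= r by rewrite le_max lexx.
  have ry : dsC R s y z <= r by rewrite le_max lexx orbT.
  (* A radius that is not positive has no meaningful logarithm; in that case [x = y]. *)
  have [r0|r0] := ltP 0 r; last first.
    have -> : x = y by apply/d_eq0/le_anti; rewrite d0 (le_trans rx).
    exact: ry.
  apply/dsC_leP => //; apply/vs_geP => q qr.
  (* The intermediate exponent leaves room for the factor two: [2 s ^ p <= s ^ q]. *)
  have [p] := rat_dense qr; rewrite ltr_rat => qp pr.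
  move/(dsC_leP _ _ r0)/vs_geP/(_ _ pr) : rx => xp.
  move/(dsC_leP _ _ r0)/vs_geP/(_ _ pr) : ry => yp.
  rewrite -(subrKA y); apply: le_trans (le_normcD _ _) _.
  by apply: le_trans (ratpow_mulrn_le s0 2 si qp); rewrite mulr2n lerD.
Qed.

Lemma dsR_ultrametric : is_ultrametric (@dsR R K s).
Proof.
have [d0 d_eq0 dC dT] := dsC_ultrametric; split=> [x y|x y|x y|x y z];
  rewrite /dsR //.
by split=> [/d_eq0[]//|->]; apply/d_eq0.
Qed.

End Valuation.

(** * Sequential completeness of ultrametric spaces *)

Section MetricSpaces.
Context {R : realType} {T : Type} {d : T -> T -> R}.

(** Balls of radius [1 / (k + 1)] around suitable terms are nested by the strong triangle
    inequality, and a common point is the limit. *)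
Lemma ultrametric_sequentially_complete :
  is_ultrametric d -> spherically_complete d -> sequentially_complete d.
Proof.
move=> [d0 d_eq0 dC dT] sc a ca.
have e0 k : 0 < k.+1%:R^-1 :> R by rewrite invr_gt0 ltr0Sn.
pose N0 k := projT1 (cid (ca _ (e0 k))).
have N0P k m n : (N0 k <= m)%N -> (N0 k <= n)%N -> d (a m) (a n) < k.+1%:R^-1.
  exact: (projT2 (cid (ca _ (e0 k)))).
(* Summing the thresholds makes them nondecreasing while still dominating [N0 k]. *)
pose N k := (\sum_(i < k.+1) N0 i)%N.
have N0N k : (N0 k <= N k)%N by rewrite /N big_ord_recr leq_addl.
have NS k : (N k <= N k.+1)%N by rewrite {2}/N big_ord_recr leq_addr.
have [k y /= ay|l /= lP] := sc (a \o N) (fun k => k.+1%:R^-1) e0.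
  rewrite /dball_closed /=; apply: le_trans (dT _ (a (N k.+1)) _) _.
  rewrite ge_max; apply/andP; split.
    exact/ltW/N0P/(leq_trans (N0N k))/NS.
  by apply: le_trans ay _; rewrite lef_pV2 ?posrE ?ltr0Sn // ler_nat.
exists l; apply/cvgr0Pnorm_lt => e /ltr_add_invr[k].
rewrite add0r => ke; exists (N k) => // n /= kn.
rewrite ger0_norm ?d0 //; apply: le_lt_trans (dT _ (a (N k)) _) _.
rewrite gt_max (le_lt_trans (lP k Logic.I) ke) andbT.
by apply: lt_trans ke; apply: N0P => //; exact: leq_trans kn.
Qed.

End MetricSpaces.

(** * Topologies whose neighbourhoods come from a distance *)

Section MetricTopology.
Context {R : realType} {T : topologicalType} {d : T -> T -> R}.
Context (nbhs_dist : forall (x : T) (U : set T),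
  nbhs x U <-> exists2 r : R, 0 < r & [set y | d x y < r] `<=` U).

Lemma open_dist (U : set T) : open U <-> metric_open d U.
Proof.
rewrite openE /interior.
by split=> [oU x /oU/nbhs_dist|oU x /oU/nbhs_dist].
Qed.

Lemma converges_dist (a : nat -> T) (l : T) : converges a l <->
  forall r : R, 0 < r -> \forall n \near \oo, d l (a n) < r.
Proof.
split=> [al r r0|h U /nbhs_dist[r r0 rU]].
  by apply: (al [set y | d l y < r]); apply/nbhs_dist; exists r.
by apply: filterS (h r r0) => n /rU.
Qed.

End MetricTopology.

(** * Neighbourhoods in the order and product-order topologies *)

Lemma order_nbhsP {K : rcfType} (x : K) (U : set (order_topology K)) :
  nbhs (x : order_topology K) U <->
  exists2 e : K, 0 < e & forall y, `|x - y| < e -> U y.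
Proof.
rewrite order_nbhs_itv; split=> [[i [+ xi] iU]|[e e0 eU]]; last first.
  exists `]x - e, x + e[ => /=; first by rewrite in_itv /= ltrBlDr ltrDl e0.
  move=> y /=; rewrite in_itv /= => xy; apply: eU.
  by rewrite distrC ltr_distl.
(* Four shapes of open interval remain; the radius is the distance to the nearest endpoint, or [1]
   if there is none. *)
case: i xi iU => [[[]l|[]] [[]r|[]]] //= + iU _.
- rewrite in_itv /= => /andP[lx xr].
  exists (Num.min (x - l) (r - x)); first by rewrite lt_min !subr_gt0 lx.
  move=> y; rewrite distrC lt_min !ltr_distl.
  move=> /andP[/andP[? _] /andP[_ ?]].
  apply: iU => /=; rewrite in_itv /=; apply/andP; split; lra.
- rewrite in_itv /= andbT => lx.
  exists (x - l); first by rewrite subr_gt0.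
  move=> y; rewrite distrC ltr_distl => /andP[? _].
  apply: iU => /=; rewrite in_itv /= andbT; lra.
- rewrite in_itv /= => xr.
  exists (r - x); first by rewrite subr_gt0.
  move=> y; rewrite distrC ltr_distl => /andP[_ ?].
  apply: iU => /=; rewrite in_itv /=; lra.
- by move=> _; exists 1 => // y _; apply: iU.
Qed.

Lemma prod_order_nbhsP {K : rcfType} (z : K[i])
    (U : set (prod_order_topology K)) :
  nbhs (z : prod_order_topology K) U <->
  exists2 e : K, 0 < e & forall w, Normc.normc (z - w) < e -> U w.
Proof.
split=> [[_ [[V oV <-] Vz] VU]|[e e0 eU]].
- have : nbhs (complex.Re z : order_topology K, complex.Im z : order_topology K)
      V.
    exact: open_nbhs_nbhs.
  case=> -[A B] [/= /order_nbhsP[e e0 eA] /order_nbhsP[e' e'0 eB]] AB.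
  exists (Num.min e e'); first by rewrite lt_min e0.
  move=> w; rewrite lt_min => /andP[we we'].
  apply/VU/AB; split=> /=.
    apply: eA; apply: le_lt_trans we; have := normc_Re_le (z - w).
    by case: (z) (w) => [? ?] [? ?].
  apply: eB; apply: le_lt_trans we'; have := normc_Im_le (z - w).
  by case: (z) (w) => [? ?] [? ?].
(* Half radii, since the modulus is at most the sum of the absolute values of the two parts. *)
- pose B (x : K) := [set y : order_topology K | `|x - y| < e / 2].
  have BN x : nbhs (x : order_topology K) (B x).
    by apply/order_nbhsP; exists (e / 2); rewrite ?divr_gt0.
  have : nbhs (complex.Re z : order_topology K, complex.Im z : order_topology K)
      (B (complex.Re z) `*` B (complex.Im z)).
    by exists (B (complex.Re z), B (complex.Im z)).
  pose f (z : K[i]) : order_topology K * order_topology K :=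
    (complex.Re z, complex.Im z).
  move=> /(@initial_continuous _ _ f z) BB.
  apply: (filterS _ (BB : nbhs (z : prod_order_topology K) _)).
  move=> w [/= zwr zwi]; apply: eU.
  apply: le_lt_trans (normc_le_ReIm _) _; rewrite [e]splitr.
  by apply: ltrD; [move: zwr|move: zwi]; case: (z) (w) => [? ?] [? ?].
Qed.

(** * Cantor completeness and nested families *)

(** The intervals of radius [e j] around [c n], for the pairs with [D n j], form a countable family,
    which Cantor completeness covers because [T] is infinite. *)
Lemma cantor_nested {K : rcfType} {J : countType} (c : nat -> K) (e : J -> K)
    (D : nat -> pred J) : cantor_complete K ->
  (forall m n j, (m <= n)%N -> D m j -> `|c m - c n| <= e j) ->
  exists y, forall n j, D n j -> `|c n - y| <= e j.
Proof.
move=> [T [/infiniteP infT _ cK]] ce.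
pose I := {p : nat * J | D p.1 p.2}.
have [] := cK I (fun i => c (val i).1 - e (val i).2)
    (fun i => c (val i).1 + e (val i).2).
- exact: card_le_trans (countableP _) infT.
(* The centre of largest index in a finite subfamily lies in all its intervals. *)
- move=> F _; exists (c (\max_(i <- finmap.enum_fset F) (val i).1)) => i /= iF.
  rewrite in_itv /= -ler_distl distrC; apply: ce (valP i).
  exact: leq_bigmax_seq.
- move=> y yP; exists y => n j Dnj; rewrite distrC ler_distl.
  exact: (yP (exist _ (n, j) Dnj) Logic.I).
Qed.

(** All that the later arguments keep of the inclusions between balls. *)
Lemma nested_ball_center {R : realType} {T : Type} {d : T -> T -> R}
    (c : nat -> T) (r : nat -> R) (m n : nat) :
  is_ultrametric d -> (forall n, 0 < r n) ->
  (forall n,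
    dball_closed d (c n.+1) (r n.+1) `<=` dball_closed d (c n) (r n)) ->
  (m <= n)%N -> d (c m) (c n) <= r m.
Proof.
move=> [_ d_eq0 _ _] r0 sub mn.
have cn : dball_closed d (c n) (r n) (c n).
  by rewrite /dball_closed /= (d_eq0 _ _).2 // ltW.
suff : dball_closed d (c n) (r n) `<=` dball_closed d (c m) (r m) by apply.
elim: n mn {cn} => [|n IH]; first by rewrite leqn0 => /eqP ->.
rewrite leq_eqVlt => /predU1P[-> //|/IH]; exact: subset_trans (sub n).
Qed.

(** * Spherical completeness of [K] and [K[i]] *)

Section SphericalCompleteness.
Context {R : realType} {K : rcfType} {s : K} (hs : infinitesimal_scale s).

Let s0 : 0 < s. Proof. by case: hs. Qed.
Let si : infinitesimal s. Proof. by case: hs. Qed.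

Lemma dsC_le_rat (x y : K[i]) (r : R) : 0 < r -> dsC R s x y <= r <->
  forall q : rat, ratr q < - ln r -> Normc.normc (x - y) <= ratpow s q.
Proof. by move=> r0; apply: iff_trans (dsC_leP x y r0) (vs_geP hs _ _). Qed.

(** The radius is the same on both sides: the factor two from [|z| <= |Re z| + |Im z|] is absorbed
    by a rational strictly between [q] and [- ln r]. *)
Lemma dsC_le_ReIm (x y : K[i]) (r : R) : 0 < r -> dsC R s x y <= r <->
  dsR R s (complex.Re x) (complex.Re y) <= r /\
  dsR R s (complex.Im x) (complex.Im y) <= r.
Proof.
case: x y => [a b] [a' b'] r0; rewrite /dsR !dsC_le_rat // -!rmorphB.
split=> [h|[ha hb]].
  split=> q /h nq; rewrite normcR; apply: le_trans nq.
    exact: (normc_Re_le ((a - a') +i* (b - b'))%C).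
  exact: (normc_Im_le ((a - a') +i* (b - b'))%C).
move=> q qr; have [p] := rat_dense qr; rewrite ltr_rat => qp pr.
apply: le_trans (normc_le_ReIm _) _.
apply: le_trans (ratpow_mulrn_le s0 2 si qp); rewrite mulr2n.
by apply: lerD; [have := ha p pr|have := hb p pr]; rewrite normcR.
Qed.

(* A ball for [dsR] of radius [r] is the intersection of the intervals of
   radius [s ^ q], with [q < - ln r] rational. *)
Lemma dsR_nested (c : nat -> K) (r : nat -> R) : cantor_complete K ->
  (forall n, 0 < r n) ->
  (forall m n, (m <= n)%N -> dsR R s (c m) (c n) <= r m) ->
  exists y, forall n, dsR R s (c n) y <= r n.
Proof.
move=> cK r0 cr.
have dE x y n : dsR R s x y <= r n <->
    forall q : rat, ratr q < - ln (r n) -> `|x - y| <= ratpow s q.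
  by rewrite /dsR dsC_le_rat // -rmorphB; split=> h q /h; rewrite normcR.
have [m n q mn /= qm|y yP] := @cantor_nested K rat c (ratpow s)
    (fun n q => ratr q < - ln (r n)) cK.
  by have /dE := cr _ _ mn; apply.
by exists y => n; apply/dE => q; apply: yP.
Qed.

Lemma dsR_spherically_complete :
  cantor_complete K -> spherically_complete (@dsR R K s).
Proof.
move=> cK c r r0 sub.
have [m n mn|y yP] := @dsR_nested c r cK r0; last by exists y => n _; exact: yP.
exact: nested_ball_center (dsR_ultrametric hs) r0 sub mn.
Qed.

Lemma dsC_spherically_complete :
  cantor_complete K -> spherically_complete (@dsC R K s).
Proof.
move=> cK c r r0 sub.
have cP m n : (m <= n)%N -> dsC R s (c m) (c n) <= r m.
  exact: nested_ball_center (dsC_ultrametric hs) r0 sub.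
have [|x xP] := @dsR_nested (fun n => complex.Re (c n)) r cK r0.
  by move=> m n /cP/(dsC_le_ReIm _ _ (r0 m))[].
have [|y yP] := @dsR_nested (fun n => complex.Im (c n)) r cK r0.
  by move=> m n /cP/(dsC_le_ReIm _ _ (r0 m))[].
exists (x +i* y)%C => n _; apply/dsC_le_ReIm => //.
Qed.

(** * Metric balls against neighbourhoods for the order *)

Lemma scale_ball_dsC (r : R) : 0 < r -> exists2 e : K, 0 < e &
  forall x y : K[i], Normc.normc (x - y) < e -> dsC R s x y < r.
Proof.
(* Any rational above [- ln r] will do; the upper bound only serves density. *)
move=> r0; have /rat_dense[q rq _] : - ln r < - ln r + 1 by rewrite ltrDl.
exists (ratpow s q) => [|x y xy]; first exact: ratpow_gt0.
by apply/dsC_ltP => //; apply/vs_gtP => //; exists q => //; apply: ltW.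
Qed.

Lemma dsC_ball_scale (e : K) : 0 < e -> exists2 r : R, 0 < r &
  forall x y : K[i], dsC R s x y < r -> Normc.normc (x - y) < e.
Proof.
move=> /(scale_exp_lt hs)[n ne].
(* A distance below [exp (- n)] means a valuation above [n], hence a modulus below [s ^ n < e]. *)
exists (expR (- n%:R)) => [|x y]; first exact: expR_gt0.
move=> /dsC_ltP; rewrite expRK opprK => /(_ (expR_gt0 _)).
rewrite -[n%:R](@ratr_nat R) => /vs_gt_rat => /(_ hs)/lt_trans; apply.
by rewrite ratpow_nat.
Qed.

Lemma nbhs_dsC (x : K[i]) (U : set (prod_order_topology K)) :
  nbhs (x : prod_order_topology K) U <->
  exists2 r : R, 0 < r & [set y | dsC R s x y < r] `<=` U.
Proof.
rewrite prod_order_nbhsP; split=> [[e e0 eU]|[r r0 rU]].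
  have [r r0 re] := dsC_ball_scale e0.
  by exists r => // y /re/eU.
have [e e0 er] := scale_ball_dsC r0.
by exists e => // y /er/rU.
Qed.

Lemma nbhs_dsR (x : K) (U : set (order_topology K)) :
  nbhs (x : order_topology K) U <->
  exists2 r : R, 0 < r & [set y | dsR R s x y < r] `<=` U.
Proof.
rewrite order_nbhsP; split=> [[e e0 eU]|[r r0 rU]].
  have [r r0 re] := dsC_ball_scale e0.
  by exists r => // y /re; rewrite -rmorphB normcR => /eU.
have [e e0 er] := scale_ball_dsC r0.
by exists e => // y xy; apply/rU/er; rewrite -rmorphB normcR.
Qed.

(** * Null sequences and series *)

Lemma dsC_vs (x : K[i]) (r : R) : 0 < r ->
  dsC R s 0 x < r <-> ((- ln r)%:E < vs R s x)%E.
Proof.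
have [_ _ dC _] := @dsC_ultrametric R K s hs.
by move=> r0; rewrite dC dsC_ltP // subr0.
Qed.

Lemma cvg0_vs (a : nat -> K[i]) :
  (forall r : R, 0 < r -> \forall n \near \oo, dsC R s 0 (a n) < r) <->
  (vs R s (a n) @[n --> \oo] --> +oo%E).
Proof.
rewrite cvgeyPgt; split=> h r => [|r0].
  have := h _ (expR_gt0 (- r)); apply: filterS => n.
  by move/dsC_vs; rewrite expRK opprK => /(_ (expR_gt0 _)).
by apply: filterS (h (- ln r)) => n /dsC_vs; apply.
Qed.

Lemma dsC_translate (x y z : K[i]) : dsC R s (z + x) (z + y) = dsC R s x y.
Proof. by rewrite /dsC opprD addrACA subrr add0r. Qed.

(** By translation invariance, consecutive partial sums are at distance [dsC 0 (a n)]; the strong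
    triangle inequality keeps the bound [r] however many terms are added. *)
Lemma dsC_sum_lt (a : nat -> K[i]) (r : R) (m n N : nat) : 0 < r ->
  (forall k, (N <= k)%N -> dsC R s 0 (a k) < r) ->
  (N <= m)%N -> (m <= n)%N ->
  dsC R s (\sum_(0 <= k < m) a k) (\sum_(0 <= k < n) a k) < r.
Proof.
have [_ d_eq0 _ dT] := @dsC_ultrametric R K s hs.
move=> r0 ar Nm; elim: n => [|n IH].
  by rewrite leqn0 => /eqP ->; rewrite (d_eq0 _ _).2.
rewrite leq_eqVlt => /predU1P[->|mn]; first by rewrite (d_eq0 _ _).2.
apply: le_lt_trans (dT _ (\sum_(0 <= k < n) a k) _) _.
rewrite gt_max IH //= big_nat_recr //= -{1}[X in dsC _ _ X]addr0 dsC_translate.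
exact/ar/(leq_trans Nm).
Qed.

End SphericalCompleteness.

Theorem theorem6p4 (R : realType) (two_pow_c : is_succ_card R (set R))
    (K : rcfType) (axK : Rhat_axioms R K)
    (s : K) (hs : infinitesimal_scale s) :
  [/\ (* (i) *)
      GRing.closed_field_axiom K[i],
      (* (ii) *)
      [/\ is_ultrametric (@dsR R K s) /\ is_ultrametric (@dsC R K s),
          spherically_complete (@dsR R K s) /\
            spherically_complete (@dsC R K s) &
          sequentially_complete (@dsR R K s) /\
            sequentially_complete (@dsC R K s)],
      (* (iii) *)
      (forall U : set (order_topology K),
         open U <-> metric_open (@dsR R K s) U) /\
      (forall U : set (prod_order_topology K),
         open U <-> metric_open (@dsC R K s) U) &
      (* (iv) *)
      forall a : nat -> K[i],
        [<-> @converges (prod_order_topology K) a (0 : K[i]);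
             @vs R K s (a n) @[n --> \oo] --> +oo%E;
             exists l : K[i], @converges (prod_order_topology K)
                                (fun n => \sum_(0 <= k < n) a k) l]].
Proof.
have cK := Rhat_cantor axK.
have uR := @dsR_ultrametric R K s hs; have uC := @dsC_ultrametric R K s hs.
have scR := @dsR_spherically_complete R K s hs cK.
have scC := @dsC_spherically_complete R K s hs cK.
have seqC := ultrametric_sequentially_complete uC scC.
split.
(* [K] is real closed, so [K[i]] carries the structure of an algebraically closed field. *)
- exact: solve_monicpoly.
- by do 2!split => //; exact: ultrametric_sequentially_complete.
- split=> U; first exact: (@open_dist R (order_topology K) _ (nbhs_dsR hs)).
  exact: (@open_dist R (prod_order_topology K) _ (nbhs_dsC hs)).
- move=> a.
  have cvgE := @converges_dist R (prod_order_topology K) _ (nbhs_dsC hs).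
  have [_ _ dC dT] := uC.
  tfae.
  + by move=> /cvgE/(cvg0_vs hs).
  (* Terms tending to zero make the partial sums Cauchy, and sequential completeness gives the
     limit. *)
  + move=> /(cvg0_vs hs) a0.
    have [r r0|l al] := seqC (fun n => \sum_(0 <= k < n) a k).
      have [N _ NP] := a0 r r0; exists N => m n Nm Nn.
      have [mn|/ltnW nm] := leqP m n; first exact: dsC_sum_lt Nm mn.
      by rewrite dC; exact: dsC_sum_lt Nn nm.
    exists l; apply/cvgE => r r0; move/cvgr0Pnorm_lt/(_ r r0) : al.
    apply: filterS => n; rewrite dC; apply: le_lt_trans; exact: ler_norm.
  (* [a n] is the difference of two consecutive partial sums, both close to [l]. *)
  + move=> [l /cvgE al]; apply/cvgE => r r0.
    have [N _ NP] := al r r0; exists N => // n /= Nn.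
    rewrite -(dsC_translate _ _ (\sum_(0 <= k < n) a k)) addr0.
    rewrite -big_nat_recr //=; apply: le_lt_trans (dT _ l _) _.
    rewrite gt_max dC !NP //=; exact: leqW.
Qed.
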